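(* Let $f\ge0$ be integrable on $[-\pi,\pi]$ with $\int f>0$, let $\sigma_n^2(f)=\min_{q\in\mathcal{Q}_n(1)}\int_{-\pi}^{\pi}|q(e^{i\lambda})|^2f(\lambda)\,d\lambda$ and $\sigma_n(f)=\sqrt{\sigma_n^2(f)}$. Then: (a) if $f(\lambda)>0$ for almost every $\lambda$ in some neighborhood of $0$, then $\lim_{n\to\infty}\sqrt[n]{\sigma_n(f)}=1$; (b) if $f(\lambda)=0$ for almost every $\lambda$ with $|\lambda|<\alpha$, where $0<\alpha<\pi$, then $\lim_{n\to\infty}\sqrt[n]{\sigma_n(f)}\le\cos(\alpha/2)$; in particular $\sigma_n(f)$ decreases at least exponentially.
   Context: $\mathcal{Q}_n(1)$ denotes the set of complex polynomials of degree at most $n$ with $q(1)=1$; $\sigma_n^2(f)$ is the variance of the best linear unbiased estimator of the constant mean $m$ of $X(t)=m+Y(t)$ from $X(0),\dots,X(n)$, where $Y$ is a centered stationary process with spectral density $f$.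
   Formalization: In (b) the limit of the n-th root of σ_n(f) need not exist for general f, so the bound by cos(α/2) is stated and proved for the limit superior; exponential decrease follows at once from it since cos(α/2)<1. *)

(* Defs.v *)
From HB Require Import structures.
From mathcomp Require Import all_boot all_order all_algebra.
From mathcomp Require Import all_classical all_reals all_analysis.
From mathcomp Require Import complex.
Set Implicit Arguments. Unset Strict Implicit. Unset Printing Implicit Defensive.
Import Order.TTheory GRing.Theory Num.Theory.
Import numFieldNormedType.Exports.
Local Open Scope classical_set_scope.
Local Open Scope ring_scope.

Definition expi {R : realType} (l : R) : R[i] := Complex (cos l) (sin l).

Definition abs2c {R : realType} (z : R[i]) : R := complex.Re z ^+ 2 + complex.Im z ^+ 2.

Definition Qn1 {R : realType} (n : nat) : set {poly R[i]} :=
  [set q : {poly R[i]} | (size q <= n.+1)%N /\ q.[1] = 1].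

(* sigma_n^2(f) = min_{q in Q_n(1)} \int_{-pi}^{pi} |q(e^{i l})|^2 f(l) dl
   (taken as the infimum; the minimum is attained) *)
Definition sigma2 {R : realType} (n : nat) (f : R -> R) : \bar R :=
  ereal_inf ((fun q : {poly R[i]} =>
      (\int[lebesgue_measure]_(l in `[(- pi)%R, pi%R]) (abs2c q.[expi l] * f l)%:E)%E)
    @` Qn1 n).

Definition sigma {R : realType} (n : nat) (f : R -> R) : R :=
  Num.sqrt (fine (sigma2 n f)).

(* Main.v *)
Require Import Defs.
From HB Require Import structures.
From mathcomp Require Import all_boot all_order all_algebra.
From mathcomp Require Import all_classical all_reals all_analysis.
From mathcomp Require Import complex measurable_realfun ring lra.
Import Order.TTheory GRing.Theory Num.Theory.
Import numFieldNormedType.Exports.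
Local Open Scope classical_set_scope.
Local Open Scope ring_scope.

(* The upper bounds come from the test polynomials 1 and ((1 + z) / 2)^n, the
   latter having modulus cos(l / 2)^n at e^(i l). The lower bound in (a) is a
   Remez inequality: let G be a closed subset of a short arc [0, d] whose
   measure is almost d. Transporting the extremal points of the Chebyshev
   polynomial T_n to G by the distribution function of G only increases mutual
   distances, and increases the distances to 0 by at most a small s. Lagrange
   interpolation at these nodes then bounds |q(1)| by rho^(-n) T_n(X) times the
   maximum of |q| over G, where rho < 1 and X > 1 are as close to 1 as wanted if
   d and then s / d are small. When f > 0 almost everywhere near 0, some set
   {f >= eta} has almost full measure in [0, d], and a polynomial with a small
   weighted L2 norm is small on most of it. *)

(** * Lagrange interpolation over a field *)

(** The difference between [q] and its interpolant has size at most [n] and vanishes at the [n]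
    distinct nodes, so it is zero. *)
Lemma horner_lagrange (F : fieldType) (n : nat) (x : 'I_n -> F) (q : {poly F})
    (z : F) :
  injective x -> (size q <= n)%N ->
  q.[z] = \sum_i q.[x i] * \prod_(j | j != i) ((z - x j) / (x i - x j)).
Proof.
move=> xI sq.
pose b i := \prod_(j | j != i) ((x i - x j)^-1 *: ('X - (x j)%:P)).
pose p := q - \sum_i q.[x i] *: b i.
have hb i y : (b i).[y] = \prod_(j | j != i) ((y - x j) / (x i - x j)).
  rewrite horner_prod; apply: eq_bigr => j _.
  by rewrite hornerZ hornerXsubC mulrC.
have sb i : (size (b i) <= n)%N.
  have n0 : (0 < n)%N by case: n i {xI sq b p hb x} => [[]|].
  rewrite /b scaler_prod (leq_trans (size_scale_leq _ _))// size_prod; last first.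
    by move=> j _; rewrite polyXsubC_eq0.
  under eq_bigr do rewrite size_XsubC.
  by rewrite sum_nat_const cardC1 card_ord muln2 -addnn -addSn addnK prednK.
have p0 : p = 0.
  apply: (@roots_geq_poly_eq0 _ _ (codom x)).
  - apply/allP => _ /codomP[i ->]; rewrite rootE /p !hornerE horner_sum.
    rewrite (bigD1 i)//= big1 ?addr0.
      rewrite hornerZ hb big1 ?mulr1 ?subrr// => j ji.
      by rewrite divff// subr_eq0 (inj_eq xI) eq_sym.
    move=> j ji; rewrite hornerZ hb (bigD1 i) 1?eq_sym//=.
    by rewrite subrr !mul0r mulr0.
  - by rewrite (map_inj_uniq xI) enum_uniq.
  - rewrite size_codom card_ord (leq_trans (size_polyD _ _))// geq_max sq/=.
    rewrite size_polyN (leq_trans (size_sum _ _ _))//.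
    by apply/bigmax_leqP => i _; rewrite (leq_trans (size_scale_leq _ _)).
have qE : q = \sum_i q.[x i] *: b i by apply/eqP; rewrite -subr_eq0 -/p p0.
by rewrite [in LHS]qE horner_sum; apply: eq_bigr => i _; rewrite hornerZ hb.
Qed.

(** * Chebyshev polynomials *)

Fixpoint chebyshev {R : nzRingType} (n : nat) : {poly R} :=
  match n with
  | 0 => 1
  | n1.+1 => if n1 is n2.+1 then 'X *+ 2 * chebyshev n1 - chebyshev n2 else 'X
  end.

Section Chebyshev.
Context {R : realType}.
Implicit Types (n : nat) (w t : R).

Lemma chebyshev_ind (P : nat -> Prop) :
  P 0%N -> P 1%N -> (forall n, P n -> P n.+1 -> P n.+2) -> forall n, P n.
Proof.
move=> P0 P1 PS n; suff: P n /\ P n.+1 by case.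
by elim: n => [|n [Pn Pn1]]; split=> //; apply: PS.
Qed.

Lemma size_chebyshev n : (size (chebyshev n : {poly R}) <= n.+1)%N.
Proof.
elim/chebyshev_ind: n => [||n IH0 IH1]; rewrite ?size_poly1 ?size_polyX//.
rewrite [chebyshev _]/= -/(chebyshev n.+1) (leq_trans (size_polyD _ _))//.
rewrite geq_max size_polyN (leq_trans IH0) ?andbT; last by do 2!apply: leqW.
rewrite mulrnAl -scaler_nat (leq_trans (size_scale_leq _ _))// -commr_polyX.
by rewrite (leq_trans (size_polyMleq _ _))// size_polyX addn2 /= ltnS.
Qed.

Lemma chebyshev_cos n t : (chebyshev n).[cos t] = cos (n%:R * t).
Proof.
elim/chebyshev_ind: n => [||n IH0 IH1].
- by rewrite hornerE mul0r cos0.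
- by rewrite hornerX mul1r.
- rewrite [chebyshev _]/= -/(chebyshev n.+1) !hornerE IH0 IH1.
  have -> : n.+2%:R * t = n.+1%:R * t + t by rewrite -[n.+2]addn1; ring.
  have -> : n%:R * t = n.+1%:R * t - t by rewrite -[n.+1]addn1; ring.
  by rewrite cosB cosD; ring.
Qed.

(** Both sides satisfy the same three-term recurrence. This is the hyperbolic form of the cosine
    identity, giving values at points beyond 1. *)
Lemma chebyshev_joukowski n w : w != 0 ->
  (chebyshev n).[(w + w^-1) / 2] = (w ^+ n + w ^- n) / 2.
Proof.
move=> w0; elim/chebyshev_ind: n => [||n IH0 IH1].
- by rewrite hornerE expr0 invr1; field.
- by rewrite hornerX expr1.
- rewrite [chebyshev _]/= -/(chebyshev n.+1) !hornerE IH0 IH1 !exprSr.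
  by have := expf_neq0 n w0; move: (w ^+ n) => v v0; field; apply/andP.
Qed.

(** These are the extremal points of the n-th Chebyshev polynomial on [-1, 1], listed from right to
    left. *)
Definition chebyshev_node n (k : 'I_n.+1) : R := cos (k%:R * (pi / n%:R)).

Lemma chebyshev_node_lt n : (0 < n)%N ->
  forall j k : 'I_n.+1, (chebyshev_node n k < chebyshev_node n j) = (j < k)%N.
Proof.
move=> n0 j k; have n0' : 0 < n%:R :> R by rewrite ltr0n.
have pn : 0 < pi / n%:R :> R by rewrite divr_gt0// pi_gt0.
have D (i : 'I_n.+1) : i%:R * (pi / n%:R) \in `[0, pi :> R].
  rewrite in_itv/= mulr_ge0 ?ler0n ?(ltW pn)//=.
  rewrite mulrCA -[leRHS]mulr1 ler_pM2l ?pi_gt0// ler_pdivrMr// mul1r ler_nat.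
  by rewrite -ltnS.
by rewrite ltr_cos// ltr_pM2r// ltr_nat.
Qed.

Lemma chebyshev_node_inj n : (0 < n)%N -> injective (chebyshev_node n).
Proof.
move=> n0 j k jk; apply/val_inj; case: (ltngtP j k) => // lt_jk.
  by have := chebyshev_node_lt n n0 j k; rewrite jk ltxx lt_jk.
by have := chebyshev_node_lt n n0 k j; rewrite jk ltxx lt_jk.
Qed.

(* At the extremal points the Chebyshev polynomial alternates between 1 and
   -1, which is exactly the sign pattern of the Lagrange denominators. *)
Lemma chebyshev_lagrange n (X : R) : (0 < n)%N ->
  \sum_k \prod_(j | j != k)
     ((X - chebyshev_node n j) / `|chebyshev_node n k - chebyshev_node n j|) =
  (chebyshev n).[X].
Proof.
move=> n0; have uI := @chebyshev_node_inj n n0.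
rewrite (@horner_lagrange _ _ (chebyshev_node n) _ X uI (size_chebyshev n)).
apply: eq_bigr => k _; rewrite chebyshev_cos.
have -> : n%:R * (k%:R * (pi / n%:R)) = k%:R * pi :> R.
  by field; rewrite pnatr_eq0 -lt0n.
have -> : cos (k%:R * pi) = (-1) ^+ k :> R.
  by rewrite mulr_natl; elim: (k : nat) => [|m IH];
    rewrite ?cos0// mulrSr cosDpi IH exprS mulN1r.
(* Exactly [k] indices lie below [k], and these are the ones whose denominators are negative. *)
have -> : (-1) ^+ k = \prod_(j : 'I_n.+1 | j != k) (-1) ^+ (j < k)%N :> R.
  rewrite prodrXr; congr (_ ^+ _).
  rewrite -big_mkcondr/= (eq_bigl (fun j : 'I_n.+1 => (j < k)%N)).
    by rewrite (big_ord_narrow (ltnW (ltn_ord k))) sum1_card card_ord.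
  move=> j; case: (ltnP j k) => lt_jk; rewrite ?andbF// andbT.
  by apply: contraTneq lt_jk => ->; rewrite ltnn.
rewrite -big_split/=; apply: eq_bigr => j jk.
have [lt_jk|le_kj] := ltnP j k.
  rewrite ltr0_norm ?subr_lt0 ?chebyshev_node_lt//.
  by rewrite expr1 invrN; ring.
rewrite gtr0_norm ?mul1r// subr_gt0 chebyshev_node_lt// ltn_neqAle le_kj.
by rewrite andbT eq_sym.
Qed.

Lemma chebyshev_lagrange_le n w : (0 < n)%N -> 1 <= w ->
  \sum_k \prod_(j | j != k) (((w + w^-1) / 2 - chebyshev_node n j) /
     `|chebyshev_node n k - chebyshev_node n j|) <= w ^+ n.
Proof.
move=> n0 w1; have w0 : 0 < w by rewrite (lt_le_trans ltr01).
rewrite chebyshev_lagrange// chebyshev_joukowski ?gt_eqF//.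
rewrite ler_pdivrMr// mulr_natr mulr2n lerD2l.
by rewrite (@le_trans _ _ 1) ?exprn_ege1 ?invf_le1 ?exprn_gt0// exprn_ege1.
Qed.

End Chebyshev.

(** * Lagrange interpolation on the unit circle *)

Section UnitCircle.
Context {R : realType}.
Implicit Types (a b x rho : R) (z : R[i]).

Lemma abs2c_ge0 z : 0 <= abs2c z.
Proof. by rewrite addr_ge0 ?sqr_ge0. Qed.

Lemma abs2cM z1 z2 : abs2c (z1 * z2) = abs2c z1 * abs2c z2.
Proof. by case: z1 => a b; case: z2 => c d; rewrite /abs2c/=; ring. Qed.

Lemma abs2cX z n : abs2c (z ^+ n) = abs2c z ^+ n.
Proof.
elim: n => [|n IH]; last by rewrite !exprS abs2cM IH.
by rewrite !expr0 /abs2c/= expr1n expr0n addr0.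
Qed.

Lemma expi0 : expi 0 = 1 :> R[i].
Proof. by rewrite /expi cos0 sin0. Qed.

(** Chord length: the squared modulus is 2 - 2 cos(a - b), which the half-angle formula turns into a
    square. *)
Lemma norm_expiB a b :
  `|expi a - expi b| = (2 * `|sin ((a - b) / 2)|)%:C%C.
Proof.
rewrite normc_def; congr (_%:C%C); rewrite -[X in _ = X * _]ger0_norm//.
rewrite -normrM -sqrtr_sqr; congr Num.sqrt => /=.
have -> : (2 * sin ((a - b) / 2)) ^+ 2 = 2 - 2 * cos (a - b).
  have {2}-> : a - b = ((a - b) / 2) *+ 2 by rewrite mulr2n; field.
  by rewrite cos_mulr2n exprMn sin2cos2; ring.
by rewrite cosB; have := cos2Dsin2 a; have := cos2Dsin2 b; lra.
Qed.

Lemma sin_MVT x : 0 <= x -> exists2 c, c \in `[0, x] & sin x = cos c * x.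
Proof.
move=> x0; have sin_cont : {within `[0, x], continuous (@sin R)}.
  by apply: continuous_subspaceT => y; exact: continuous_sin.
have [c cx] := MVT_segment x0 (fun y _ => is_derive_sin y) sin_cont.
by rewrite sin0 !subr0; exists c.
Qed.

Lemma norm_sin_le x : `|sin x| <= `|x|.
Proof.
wlog x0 : x / 0 <= x.
  move=> H; have [/H//|/ltW] := leP 0 x; rewrite -oppr_ge0 => /H.
  by rewrite sinN !normrN.
have [c _ ->] := sin_MVT x x0; rewrite normrM ler_piMl//.
exact: cos_max.
Qed.

(** By the mean value theorem sin x = x cos c, and cos c exceeds [rho] near 0. Short chords are thus
    almost as long as their arcs. *)
Lemma norm_sin_ge_near0 rho : 0 < rho < 1 ->
  exists2 D, 0 < D & forall x, `|x| <= D -> rho * `|x| <= `|sin x|.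
Proof.
move=> /andP[rho0 rho1].
have : \forall c \near (0 : R), rho < cos c.
  have := @continuous_cos R 0; rewrite /continuous_at cos0 => cos_cvg.
  exact: cvgr_gt cos_cvg _ rho1.
move=> /nbhs_ballP[e /= e0 He]; exists (e / 2); first by rewrite divr_gt0.
move=> x; wlog x0 : x / 0 <= x.
  move=> H; have [/H//|/ltW] := leP 0 x; rewrite -oppr_ge0 => /H.
  by rewrite sinN !normrN.
rewrite (ger0_norm x0) => xe; have [c] := sin_MVT x x0.
rewrite in_itv/= => /andP[c0 cx] ->.
rewrite normrM (ger0_norm x0) ler_wpM2r// (le_trans _ (ler_norm _))// ltW//.
by apply: He; rewrite /ball/= sub0r normrN ger0_norm//; lra.
Qed.

(* With X = (w + w^-1) / 2, L (1 - u k) / 2 + s <= L (X - u k) / 2, so that the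
   Lagrange weights at the point 1 are bounded by those of the Chebyshev
   polynomial at X. *)
Lemma remez_nodes n (q : {poly R[i]}) (l : 'I_n.+1 -> R) (rho w L s B : R) :
  let u := @chebyshev_node R n in
  (0 < n)%N -> Qn1 n q -> 0 < rho -> 1 <= w -> 0 < L ->
  s <= L / 2 * ((w + w^-1) / 2 - 1) ->
  (forall k, 0 <= l k <= L / 2 * (1 - u k) + s) ->
  (forall j k, L / 2 * `|u k - u j| <= `|l k - l j|) ->
  (forall j k, rho * `|l k - l j| <= 2 * `|sin ((l k - l j) / 2)|) ->
  (forall k, abs2c q.[expi (l k)] <= B ^+ 2) -> 0 <= B ->
  1 <= B * (w / rho) ^+ n.
Proof.
move=> u n0 [sq q1] rho0 w1 L0 sL ls lu lsin qB B0.
have uI : injective u by exact: chebyshev_node_inj.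
set X := (w + w^-1) / 2 in sL.
have w0 : 0 < w by rewrite (lt_le_trans ltr01).
have dist j k : rho * (L / 2 * `|u k - u j|) <= 2 * `|sin ((l k - l j) / 2)|.
  by rewrite (le_trans _ (lsin j k))// ler_wpM2l ?(ltW rho0).
(* Equal points have chord 0, and [dist] then forces equal Chebyshev nodes. *)
have zI : injective (fun k => expi (l k)).
  move=> k j /eqP; rewrite -subr_eq0 -normr_eq0 norm_expiB.
  move=> /eqP [] h; have := dist j k; rewrite h => d0.
  apply: uI; apply/eqP; rewrite -subr_eq0 -normr_le0.
  by move: d0; rewrite pmulr_rle0// pmulr_rle0// divr_gt0.
have X1 : 1 <= X.
  rewrite /X ler_pdivlMr// mul1r -subr_ge0.
  have -> : w + w^-1 - 2 = (w - 1) ^+ 2 / w by field; rewrite gt_eqF.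
  by rewrite divr_ge0 ?sqr_ge0 ?ltW.
have Xu j : 0 <= X - u j by rewrite subr_ge0 (le_trans (cos_le1 _)).
rewrite -lecR.
have -> : (1 : R)%:C%C = `|q.[1]| by rewrite q1 normr1.
rewrite (@horner_lagrange _ _ _ _ 1 zI sq).
rewrite (le_trans (ler_norm_sum _ _ _))//.
apply: (@le_trans _ _ (\sum_(k < n.+1) (B * rho ^- n *
   \prod_(j | j != k) ((X - u j) / `|u k - u j|))%:C%C)).
  apply: ler_sum => k _; rewrite normrM normr_prod -mulrA rmorphM/=.
  (* Each of the [n] Lagrange factors receives one [rho^-1], the loss in passing from arc to chord
     in its denominator. *)
  have -> : rho ^- n = \prod_(j : 'I_n.+1 | j != k) rho^-1.
    by rewrite prodr_const cardC1 card_ord exprVn.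
  rewrite -big_split/= [in leRHS]rmorph_prod/=.
  apply: ler_pM => //; first by apply: prodr_ge0.
    rewrite normc_def lecR -[B in leRHS]ger0_norm// -sqrtr_sqr.
    exact/ler_wsqrtr/qB.
  apply: ler_prod => j jk; rewrite normr_ge0/= normrM normfV.
  rewrite -expi0 !norm_expiB -fmorphV -rmorphM lecR.
  have ukj : 0 < `|u k - u j| by rewrite normr_gt0 subr_eq0 (inj_eq uI) eq_sym.
  have -> : rho^-1 * ((X - u j) / `|u k - u j|) =
      (L / 2 * (X - u j)) / (rho * (L / 2 * `|u k - u j|)).
    by field; rewrite !gt_eqF.
  have d0 : 0 < rho * (L / 2 * `|u k - u j|) by rewrite !mulr_gt0// divr_gt0.
  apply: ler_pM => //.
  - rewrite sub0r mulNr sinN normrN.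
    have /andP[lj0 lj] := ls j.
    apply: (@le_trans _ _ (l j)).
      have := norm_sin_le (l j / 2); rewrite [leRHS]ger0_norm ?divr_ge0// => h.
      by lra.
    by apply: (le_trans lj); lra.
  - by rewrite lef_pV2 ?posrE ?(lt_le_trans d0).
rewrite -rmorph_sum/= lecR -mulr_sumr -mulrA ler_wpM2l// expr_div_n mulrC.
rewrite ler_wpM2r ?invr_ge0 ?exprn_ge0 ?(ltW rho0)//.
exact: chebyshev_lagrange_le.
Qed.

End UnitCircle.

(** * A Remez inequality on an arc *)

Section Remez.
Context {R : realType}.
Implicit Types (G : set R) (x y d t : R).
Local Notation mu := (@lebesgue_measure R).

(** The distribution function of [G], real-valued because the mass in a bounded interval is
    finite. *)
Definition mass_upto G x : R := fine (mu (G `&` `[0, x])).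

Lemma mass_uptoE G x : measurable G -> mu (G `&` `[0, x]) = (mass_upto G x)%:E.
Proof.
move=> mG; rewrite fineK// ge0_fin_numE//.
apply: (@le_lt_trans _ _ (mu `[0, x])); last first.
  by rewrite lebesgue_measure_itv/=; case: ifP; rewrite -?EFinD ltry.
by apply: le_measure; rewrite ?inE//; exact: measurableI.
Qed.

Lemma mass_upto0 G : mass_upto G 0 = 0.
Proof.
rewrite /mass_upto; suff -> : mu (G `&` `[0, 0]) = 0%E by [].
apply/eqP; rewrite -measure_le0 -(lebesgue_measure_set1 0).
apply: (@le_trans _ _ (mu [set 0])) => //.
rewrite set_itv1; have [G0|G0] := pselect (G 0).
  by rewrite (_ : G `&` [set 0] = [set 0])//; apply/setIidPr => _ ->.
rewrite (_ : G `&` [set 0] = set0) ?measure0//.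
by apply/seteqP; split=> // z [Gz z0]; apply: G0; rewrite -z0.
Qed.

Lemma mass_upto_le G x y : measurable G -> x <= y ->
  mass_upto G x <= mass_upto G y.
Proof.
move=> mG xy; rewrite -lee_fin -!mass_uptoE//.
apply: le_measure; rewrite ?inE; [exact: measurableI|exact: measurableI|].
by apply: setIS => z /=; rewrite !in_itv/= => /andP[-> /le_trans]; exact.
Qed.

Lemma mass_upto_gap G x y : measurable G -> x <= y ->
  (forall z, G z -> x < z -> y < z) -> mass_upto G y = mass_upto G x.
Proof.
move=> mG xy gap; rewrite /mass_upto; congr (fine (mu _)).
apply/seteqP; split=> z [Gz] /=; rewrite !in_itv/= => /andP[z0 zy];
  split=> //; rewrite z0/=; last exact: le_trans zy xy.
by rewrite leNgt; apply/negP => /(gap z Gz); rewrite ltNge zy.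
Qed.

(** The mass gained is at most the length of []x, y]]. Hence points of [G] are at least as far apart
    as their mass levels, which is what makes the transport expand distances. *)
Lemma mass_upto_lipschitz G x y : measurable G -> x <= y ->
  mass_upto G y <= mass_upto G x + (y - x).
Proof.
move=> mG xy; rewrite -lee_fin EFinD -!mass_uptoE//.
have -> : (y - x)%:E = mu `]x, y].
  rewrite lebesgue_measure_itv/= lte_fin; case: ltgtP xy => // -> _.
  by rewrite subrr.
apply: (@le_trans _ _ (mu ((G `&` `[0, x]) `|` `]x, y]))); last first.
  by apply: measureU2 => //; exact: measurableI.
apply: le_measure; rewrite ?inE; first exact: measurableI.
  by apply: measurableU => //; exact: measurableI.
move=> z [Gz] /=; rewrite !in_itv/= => /andP[z0 zy].
by case: (leP z x) => zx; [left; split=> //|right];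
  rewrite /= ?in_itv/= ?z0 ?zx ?zy.
Qed.

(** The witness is the last point with mass at most [t]. The mass exceeds [t] immediately to its
    right, so points of [G] accumulate there and closedness puts it in [G]. *)
Lemma mass_upto_surj G d t : closed G -> 0 <= d -> 0 <= t < mass_upto G d ->
  exists2 x, G x /\ 0 <= x <= d & mass_upto G x = t.
Proof.
move=> cG d0 /andP[t0 td]; have mG := closed_measurable cG.
pose A := [set x | 0 <= x <= d /\ mass_upto G x <= t].
have A0 : A 0 by rewrite /A/= lexx d0 mass_upto0.
have supA : has_sup A by split; [exists 0|exists d => x [/andP[]]].
have x0 : 0 <= sup A by apply: ub_le_sup => //; exact: supA.2.
have xd : sup A <= d by apply: ge_sup; [exists 0|move=> x [/andP[]]].
have xt : mass_upto G (sup A) <= t.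
  apply/ler_addgt0Pr => e e0.
  have [a [/andP[a0 ad] at_] ae] := sup_adherent e0 supA.
  have aS : a <= sup A by apply: ub_le_sup; [exact: supA.2|split; rewrite ?a0].
  have := @mass_upto_lipschitz G a (sup A) mG aS; lra.
have xd' : sup A < d.
  rewrite lt_neqAle xd andbT; apply: contraTneq td => <-.
  by rewrite -leNgt.
have gt_t y : sup A < y <= d -> t < mass_upto G y.
  move=> /andP[Ay yd]; rewrite ltNge; apply/negP => yt.
  have : y <= sup A.
    apply: ub_le_sup; [exact: supA.2|split=> //].
    by rewrite yd (le_trans x0)// ltW.
  by rewrite leNgt Ay.
exists (sup A); last first.
  apply/eqP; rewrite eq_le xt/=; apply/ler_addgt0Pr => e e0.
  pose y := Num.min d (sup A + e).
  have Ay : sup A < y by rewrite lt_min xd'/= ltrDl.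
  have yd : y <= d by rewrite ge_min lexx.
  have yA : y - sup A <= e by rewrite lerBlDl ge_min lexx orbT.
  have := gt_t y; rewrite Ay yd => /(_ isT).
  have := @mass_upto_lipschitz G (sup A) y mG (ltW Ay); lra.
split; last by rewrite x0.
apply: contrapT => nG.
have /nbhs_ballP[e /= e0 He] : nbhs (sup A) (~` G).
  by apply: open_nbhs_nbhs; split; [exact: closed_openC|].
(* The interval from [sup A] to [y] avoids [G], so the mass could not have grown past [t] at [y]. *)
pose y := Num.min d (sup A + e / 2).
have Ay : sup A < y by rewrite lt_min xd'/= ltrDl divr_gt0.
have yd : y <= d by rewrite ge_min lexx.
have ye : y <= sup A + e / 2 by rewrite ge_min lexx orbT.
have := gt_t y; rewrite Ay yd => /(_ isT).
rewrite (@mass_upto_gap G (sup A) y mG (ltW Ay)); first by rewrite ltNge xt.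
move=> z Gz Az; rewrite ltNge; apply/negP => zy; apply: (He z) => //.
by rewrite /ball/= ltr0_norm ?subr_lt0// opprB; lra.
Qed.

(** One factor [rho^-1] pays for replacing arcs by chords, the other is the growth parameter [w] of
    the Chebyshev polynomial at X > 1. *)
Lemma remez_arc (rho : R) : 0 < rho < 1 ->
  exists2 D : R, 0 < D & forall d, 0 < d <= D -> exists2 s, 0 < s < d &
    forall n (q : {poly R[i]}) G B, (0 < n)%N -> Qn1 n q -> closed G ->
      G `<=` `[0, d] -> ((d - s)%:E < mu G)%E -> 0 <= B ->
      (forall x, G x -> abs2c q.[expi x] <= B ^+ 2) ->
      1 <= B * (rho ^- 2) ^+ n.
Proof.
move=> rho01; have /andP[rho0 rho1] := rho01.
have [D D0 HD] := norm_sin_ge_near0 rho rho01; exists D => // d /andP[d0 dD].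
have w1 : 1 <= rho^-1 by rewrite invf_ge1// ltW.
pose X := (rho^-1 + rho^-1^-1) / 2.
have X1 : 0 < X - 1.
  have -> : X - 1 = (1 - rho) ^+ 2 / (2 * rho).
    by rewrite /X invrK; field; rewrite gt_eqF.
  by rewrite divr_gt0 ?mulr_gt0 ?subr_gt0.
have X2 : 0 < X + 1 by lra.
(* This solves s = (d - s) / 2 * (X - 1), the largest excess that [remez_nodes] admits for L = d -
   s. *)
pose s := d * (X - 1) / (X + 1).
have s0 : 0 < s by rewrite divr_gt0// mulr_gt0.
have L0 : 0 < d - s.
  have -> : d - s = 2 * d / (X + 1) by rewrite /s; field; rewrite gt_eqF.
  by rewrite divr_gt0// mulr_gt0.
exists s; first by rewrite s0 -subr_gt0.
move=> n q G B n0 qn cG Gd Gs B0 qB; have mG := closed_measurable cG.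
pose u := @chebyshev_node R n; pose L := d - s.
have Gm : mu G = (mass_upto G d)%:E.
  by rewrite -mass_uptoE// (_ : G `&` _ = G)//; exact/setIidPl.
have Lm : L < mass_upto G d by rewrite -lte_fin -Gm.
have u1 k : -1 <= u k <= 1 by rewrite cos_geN1 cos_le1.
(* The affine image of the k-th Chebyshev node in [0, L] is used as a mass level and pulled back to
   a point of [G]. *)
have node k : exists x, [/\ G x, 0 <= x <= d & mass_upto G x = L / 2 * (1 - u k)].
  have tm : 0 <= L / 2 * (1 - u k) < mass_upto G d.
    have /andP[uk1 uk2] := u1 k.
    rewrite mulr_ge0 ?divr_ge0 ?(ltW L0) ?subr_ge0//=.
    rewrite (le_lt_trans _ Lm)// -[leRHS]mulr1 -mulrA ler_pM2l//.
    by rewrite mulrC ler_pdivrMr// mul1r; lra.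
  have [x [Gx xd] xt] := mass_upto_surj G d _ cG (ltW d0) tm.
  by exists x.
have [l Hl] := choice node.
have -> : rho ^- 2 = rho^-1 / rho by rewrite -exprVn expr2.
apply: (@remez_nodes R n q l rho rho^-1 L s B) => //.
- rewrite -/X /L /s le_eqVlt; apply/orP; left; apply/eqP.
  by field; rewrite gt_eqF.
(* The part of [0, d] missed by [G] has length below [s], so a point exceeds its mass level by less
   than [s]. *)
- move=> k; have [_ /andP[l0 ld] lk] := Hl k; rewrite l0/= -lk.
  have := @mass_upto_lipschitz G (l k) d mG ld; rewrite /L in Lm; lra.
- have le_case j k : l j <= l k -> L / 2 * `|u k - u j| <= l k - l j.
    move=> jk; have [_ _ lj] := Hl j; have [_ _ lk] := Hl k.
    have := mass_upto_lipschitz G _ _ mG jk; have := mass_upto_le G _ _ mG jk.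
    rewrite lj lk ler_pM2l ?divr_gt0// => h1 h2.
    by rewrite ler0_norm; lra.
  move=> j k; have [jk|/ltW kj] := leP (l j) (l k).
    by rewrite (ger0_norm (_ : 0 <= l k - l j)) ?subr_ge0// le_case.
  by rewrite (distrC (u k)) (distrC (l k)) [leRHS]ger0_norm ?subr_ge0// le_case.
- move=> j k; have [_ /andP[j0 jd] _] := Hl j; have [_ /andP[k0 kd] _] := Hl k.
  have : `|(l k - l j) / 2| <= D.
    by rewrite ler_norml; apply/andP; split; lra.
  by move=> /HD; rewrite normrM (ger0_norm (_ : 0 <= 2^-1))//; lra.
- by move=> k; apply: qB; have [] := Hl k.
Qed.

End Remez.

(** * Continuity of the integrand and superlevel sets of the density *)

Section Sigma.
Context {R : realType}.
Local Notation mu := (@lebesgue_measure R).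

(** Real and imaginary parts go through the induction together, since multiplication by [expi x]
    mixes them. *)
Lemma continuous_abs2c_horner_expi (q : {poly R[i]}) :
  continuous (fun x : R => abs2c q.[expi x]).
Proof.
suff [cRe cIm] : continuous (fun x : R => complex.Re q.[expi x]) /\
                 continuous (fun x : R => complex.Im q.[expi x]).
  by move=> x; apply: cvgD; rewrite /=; [apply: cvgM; exact: cRe|apply: cvgM; exact: cIm].
elim/poly_ind: q => [|p [a b] [cRe cIm]].
  by split=> x; under eq_fun do rewrite horner0 /=; exact: cvg_cst.
have E x : (p * 'X + (Complex a b)%:P).[expi x] =
    Complex (complex.Re p.[expi x] * cos x - complex.Im p.[expi x] * sin x + a)
            (complex.Re p.[expi x] * sin x + complex.Im p.[expi x] * cos x + b).
  by rewrite !hornerE; case: p.[expi x].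
split=> x; under eq_fun do rewrite E /=.
- apply: cvgD; last exact: cvg_cst.
  apply: cvgB; apply: cvgM; by [exact: cRe|exact: cIm|exact: continuous_cos|
    exact: continuous_sin].
- apply: cvgD; last exact: cvg_cst.
  apply: cvgD; apply: cvgM; by [exact: cRe|exact: cIm|exact: continuous_cos|
    exact: continuous_sin].
Qed.

(** The sets where f >= 1/(k+1) increase to almost all of [0, d]. Continuity of measure costs
    [e / 2], and inner regularity by a compact set costs the other half. *)
Lemma positive_ae_superlevel (f : R -> R) (d e : R) : 0 < d -> 0 < e ->
  measurable_fun `[0, d] (EFin \o f) ->
  {ae mu, forall x, x \in `[0, d] -> 0 < f x} ->
  exists2 eta, 0 < eta & exists2 K : set R, compact K &
    K `<=` `[0, d] `&` [set x | eta <= f x] /\ ((d - e)%:E < mu K)%E.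
Proof.
move=> d0 e0 mf [N [mN N0 subN]].
pose A k := `[0, d]%classic `&` [set x | ((k.+1%:R^-1 : R)%:E <= (EFin \o f) x)%E].
have mA k : measurable (A k) by exact: emeasurable_fun_c_infty.
have mU : measurable (\bigcup_k A k) by exact: bigcup_measurable.
have ndA : nondecreasing_seq A.
  move=> j k jk; apply/subsetPset => x [xd] /= fx; split=> //=.
  by rewrite (le_trans _ fx)// lee_fin lef_pV2 ?posrE// ler_nat.
have dU : (d%:E <= mu (\bigcup_k A k))%E.
  rewrite -[leRHS]adde0 -N0 (le_trans _ (measureU2 _ _ _))//.
  have -> : d%:E = mu `[0, d] by rewrite lebesgue_measure_itv/= lte_fin d0 sube0.
  apply: le_measure; rewrite ?inE//; first exact: measurableU.
  move=> x xd; have [fx|fx] := ltP 0 (f x); last first.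
    by right; apply: subN => /=; move=> /(_ xd); rewrite ltNge fx.
  left; have [k _ Hk] := near_infty_natSinv_lt (PosNum fx).
  by exists k => //; split=> //=; rewrite lee_fin ltW// (Hk k (leqnn k)).
have [k Ak] : exists k, ((d - e / 2)%:E < mu (A k))%E.
  apply: contrapT => /forallNP H.
  have : (mu (\bigcup_k A k) <= (d - e / 2)%:E)%E.
    have cvgA : mu \o A @ \oo --> mu (\bigcup_k A k).
      exact: nondecreasing_cvg_mu.
    rewrite -(cvg_lim _ cvgA)//; apply: lime_le.
      by apply/cvg_ex; eexists; exact: cvgA.
    by apply: nearW => k /=; rewrite leNgt; apply/negP/H.
  move=> /(le_trans dU); rewrite lee_fin; lra.
have finA : (mu (A k) < +oo)%E.
  apply: (@le_lt_trans _ _ (mu `[0, d])).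
    by apply: le_measure; rewrite ?inE; [exact: mA|by []|move=> x []].
  by rewrite lebesgue_measure_itv/= lte_fin d0 sube0 ltry.
have e20 : 0 < e / 2 by rewrite divr_gt0.
have [K [cK KA Ke]] := lebesgue_regularity_inner (mA k) finA e20.
have mK := compact_measurable cK.
exists k.+1%:R^-1; first by rewrite invr_gt0.
exists K => //; split; first by move=> x /KA[].
have mAK : measurable (A k `\` K) by exact: measurableD.
have : (mu (A k) <= mu K + mu (A k `\` K))%E.
  apply: (@le_trans _ _ (mu (K `|` (A k `\` K)))); last exact: measureU2.
  apply: le_measure; rewrite ?inE; [exact: mA|exact: measurableU|].
  by rewrite setUDr ?setDv ?setD0; apply: subsetUr.
move=> AK; rewrite -(lteD2rE (x := (e / 2)%:E))// -EFinD.
have -> : d - e + e / 2 = d - e / 2 by field.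
apply: (lt_le_trans Ak); apply: (le_trans AK).
by rewrite leeD2l// ltW.
Qed.

End Sigma.

(** * Bounds on sigma *)

Section Roots.
Context {R : realType}.

Lemma powR_root_scale (a r : R) n : 0 <= a -> 0 <= r -> (0 < n)%N ->
  (a * r ^+ n) `^ n%:R^-1 = a `^ n%:R^-1 * r.
Proof.
move=> a0 r0 n0; rewrite powRM ?exprn_ge0// -powR_mulrn// -powRrM divff.
  by rewrite powRr1.
by rewrite pnatr_eq0 -lt0n.
Qed.

Lemma sqrt_scale (a r : R) n : 0 <= a -> 0 <= r ->
  Num.sqrt (a * (r ^+ n) ^+ 2) = Num.sqrt a * r ^+ n.
Proof. by move=> a0 r0; rewrite sqrtrM// sqrtr_sqr ger0_norm// exprn_ge0. Qed.

Lemma cvg_powR_root (a : R) : 0 < a ->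
  (fun n : nat => a `^ n%:R^-1) @ \oo --> (1 : R).
Proof.
(* The shift skips n = 0, where the inverse takes its default value 0, and turns the exponent into
   the harmonic sequence. *)
move=> a0; rewrite -cvg_shiftS /=.
have -> : (fun n : nat => a `^ n.+1%:R^-1) = (fun n => expR (harmonic n * ln a)).
  by apply/funext => n; rewrite /powR gt_eqF.
rewrite -(expR0 R); apply: continuous_cvg; first exact: continuous_expR.
rewrite -[X in _ --> X](mul0r (ln a)); apply: cvgM; last exact: cvg_cst.
exact: cvg_harmonic.
Qed.

Lemma limn_esup_le_near (u : nat -> R) (l : R) :
  (forall e, 0 < e -> \forall n \near \oo, u n <= l + e) ->
  (limn_esup (fun n => (u n)%:E) <= l%:E)%E.
Proof.
move=> H; apply/lee_addgt0Pr => e e0; have [N _ HN] := H e e0.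
apply: (@le_trans _ _ (ereal_sup ((fun n => (u n)%:E) @` [set k | (N <= k)%N]))).
  by apply: ereal_inf_lbound; exists [set k | (N <= k)%N] => //; exists N.
by apply: ge_ereal_sup => _ [n /= Nn <-]; rewrite -EFinD lee_fin; exact: HN.
Qed.

End Roots.

(** * Energy integrals and the variance *)

Section Sigma2.
Context {R : realType} (f : R -> R).
Local Notation mu := (@lebesgue_measure R).
Hypothesis f_ge0 : forall l, l \in `[- pi, pi] -> 0 <= f l.
Hypothesis f_int : mu.-integrable `[- pi, pi] (EFin \o f).
Let energy (q : {poly R[i]}) : \bar R :=
  (\int[mu]_(l in `[(- pi)%R, pi%R]) (abs2c q.[expi l] * f l)%:E)%E.
Let total : R := fine (\int[mu]_(l in `[(- pi)%R, pi%R]) (f l)%:E)%E.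

Lemma measurable_energy (q : {poly R[i]}) :
  measurable_fun `[(- pi)%R, pi%R] (fun l => (abs2c q.[expi l] * f l)%:E).
Proof.
apply/measurable_EFinP; apply: measurable_funM.
  apply: measurable_funTS; apply: continuous_measurable_fun.
  exact: continuous_abs2c_horner_expi.
by apply/measurable_EFinP; exact: (measurable_int _ f_int).
Qed.

Lemma energy_integrand_ge0 (q : {poly R[i]}) l : l \in `[- pi, pi] ->
  (0 <= (abs2c q.[expi l] * f l)%:E)%E.
Proof. by move=> lI; rewrite lee_fin mulr_ge0 ?abs2c_ge0 ?f_ge0. Qed.

Lemma totalE : (\int[mu]_(l in `[(- pi)%R, pi%R]) (f l)%:E)%E = total%:E.
Proof. by rewrite fineK//; exact: integrable_fin_num. Qed.

Lemma total_ge0 : 0 <= total.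
Proof.
by rewrite -lee_fin -totalE; apply: integral_ge0 => l lI; rewrite lee_fin f_ge0.
Qed.

Lemma sigma2_ge0 n : (0 <= sigma2 n f)%E.
Proof.
apply: le_ereal_inf_tmp => _ [q _ <-]; apply: integral_ge0 => l lI.
exact: energy_integrand_ge0.
Qed.

Lemma sigma2_le n q : Qn1 n q -> (sigma2 n f <= energy q)%E.
Proof. by move=> qn; apply: ereal_inf_lbound; exists q. Qed.

Lemma sigma2_le_total n : (sigma2 n f <= total%:E)%E.
Proof.
rewrite -totalE (_ : (\int[mu]_(_ in _) _)%E = energy 1).
  by apply: sigma2_le; split; rewrite ?size_poly1 ?hornerE.
apply: eq_integral => l _; rewrite hornerE /abs2c /=.
by rewrite expr1n expr0n addr0 mul1r.
Qed.

(** The constant polynomial 1 makes the infimum finite, so [fine] never falls back on its default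
    value. *)
Lemma sigma2_fineK n : sigma2 n f = (fine (sigma2 n f))%:E.
Proof.
rewrite fineK// ge0_fin_numE ?sigma2_ge0//.
by rewrite (le_lt_trans (sigma2_le_total n))// ltry.
Qed.

Lemma sigma_le n (C : R) : (sigma2 n f <= C%:E)%E -> sigma n f <= Num.sqrt C.
Proof. by rewrite sigma2_fineK lee_fin => h; exact: ler_wsqrtr. Qed.

Lemma sigma_ge n (C : R) :
  (forall q, Qn1 n q -> (C%:E <= energy q)%E) -> Num.sqrt C <= sigma n f.
Proof.
move=> H; apply: ler_wsqrtr; rewrite -lee_fin -sigma2_fineK.
by apply: le_ereal_inf_tmp => _ [q qn <-]; exact: H.
Qed.

Lemma sigma_root_le n (r : R) : 0 <= r -> (0 < n)%N ->
  (sigma2 n f <= (total * (r ^+ n) ^+ 2)%:E)%E ->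
  sigma n f `^ n%:R^-1 <= Num.sqrt total `^ n%:R^-1 * r.
Proof.
move=> r0 n0 /sigma_le; rewrite sqrt_scale ?total_ge0// => h.
rewrite -powR_root_scale ?sqrtr_ge0// ge0_ler_powR ?invr_ge0// nnegrE.
  exact: sqrtr_ge0.
by rewrite mulr_ge0 ?sqrtr_ge0 ?exprn_ge0.
Qed.

(* A Remez argument: if [q] were small on most of the compact set where [f] is
   bounded below, then [q] would be less than 1 at the point 1. *)
Lemma energy_ge (delta rho : R) : 0 < delta -> 0 < rho < 1 ->
  {ae mu, forall l, l \in `]- delta, delta[ -> 0 < f l} ->
  exists2 c, 0 < c & forall n q, (0 < n)%N -> Qn1 n q ->
    ((c * ((rho ^+ 2) ^+ n) ^+ 2)%:E <= energy q)%E.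
Proof.
move=> delta0 rho01 fpos; have /andP[rho0 rho1] := rho01.
have [D D0 HD] := remez_arc rho rho01.
(* The three bounds keep [0, d] within reach of [remez_arc], inside the interval of positivity of
   [f], and inside the domain of integration. *)
pose d := Num.min D (Num.min (delta / 2) pi).
have d0 : 0 < d by rewrite !lt_min D0 divr_gt0//= pi_gt0.
have dD : d <= D by rewrite ge_min lexx.
have dd : d <= delta / 2 by rewrite !ge_min lexx orbT.
have dpi : d <= pi by rewrite !ge_min lexx !orbT.
have [s /andP[s0 sd] Hs] := HD d (introT andP (conj d0 dD)).
have sub : `[0, d] `<=` `[(- pi)%R, pi%R].
  move=> x /=; rewrite !in_itv/= => /andP[x0 xd].
  by rewrite (le_trans xd dpi) (le_trans _ x0)// oppr_le0 pi_ge0.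
have mf : measurable_fun `[0, d] (EFin \o f).
  by apply: measurable_funS (measurable_int _ f_int).
have fpos0 : {ae mu, forall x, x \in `[0, d] -> 0 < f x}.
  case: fpos => N [mN N0 subN]; exists N; split=> // x /= nfx.
  apply: subN => /= fx; apply: nfx => xd; apply: fx; move: xd.
  by rewrite !in_itv/= => /andP[x0 xd]; apply/andP; split; lra.
have s20 : 0 < s / 2 by rewrite divr_gt0.
have [eta eta0 [K cK [KA Kd]]] := positive_ae_superlevel f d (s / 2) d0 s20 mf fpos0.
have mK := compact_measurable cK.
(* This is B^2 * eta * (s / 2) without its power of [rho], for the threshold [B] below. *)
exists (eta * s / 8); first by rewrite divr_gt0// mulr_gt0.
move=> n q n0 qn; pose B := (rho ^+ 2) ^+ n / 2.
have r0 : 0 < (rho ^+ 2) ^+ n by rewrite !exprn_gt0.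
have B0 : 0 < B by rewrite divr_gt0.
pose G := K `&` [set x | abs2c q.[expi x] <= B ^+ 2].
have cG : closed G.
  apply: closedI; first by apply: compact_closed => //; exact: Rhausdorff.
  apply: (@preimage_closed _ _ (fun x => abs2c q.[expi x]) [set y | y <= B ^+ 2]).
    by move=> x _; exact: continuous_abs2c_horner_expi.
  exact: closed_le.
have mG := closed_measurable cG.
(* On a larger [G] the Remez inequality would read 1 <= 1/2, by the factor 1/2 in [B]. *)
have Gd : (mu G <= (d - s)%:E)%E.
  rewrite leNgt; apply/negP => Gs.
  have := Hs n q G B n0 qn cG _ Gs (ltW B0) _.
  have -> : B * rho ^- 2 ^+ n = 2^-1.
    by rewrite /B exprVn; field; rewrite gt_eqF.
  move=> /(_ (fun x Gx => (KA x Gx.1).1) (fun x Gx => Gx.2)); lra.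
have mKG : measurable (K `\` G) by exact: measurableD.
have KG : ((s / 2)%:E <= mu (K `\` G))%E.
  have : (mu K <= mu G + mu (K `\` G))%E.
    apply: (@le_trans _ _ (mu (G `|` (K `\` G)))); last exact: measureU2.
    apply: le_measure; rewrite ?inE//; first exact: measurableU.
    by rewrite setUDr ?setDv ?setD0; apply: subsetUr.
  move=> KGle; have := lt_le_trans Kd (le_trans KGle (leeD2r _ Gd)).
  case: (mu (K `\` G)) => [m| |//]; last by rewrite leey.
  by rewrite -EFinD lte_fin lee_fin; lra.
have KGI : K `\` G `<=` `[(- pi)%R, pi%R] by move=> x [/KA[xd _] _]; exact: sub.
apply: (@le_trans _ _ (\int[mu]_(l in K `\` G) (B ^+ 2 * eta)%:E)%E); last first.
  apply: (@le_trans _ _ (\int[mu]_(l in K `\` G) (abs2c q.[expi l] * f l)%:E)%E).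
    apply: ge0_le_integral => //.
    - by move=> x _; rewrite lee_fin mulr_ge0 ?sqr_ge0 ?ltW.
    - exact: measurable_funS (measurable_energy q).
    - move=> x [Kx nG]; rewrite lee_fin ler_pM ?sqr_ge0 ?(ltW eta0)//.
        by rewrite ltW// ltNge; apply/negP => h; apply: nG.
      by have [] := KA x Kx.
  apply: ge0_subset_integral => //; first exact: measurable_energy.
  by move=> x; exact: energy_integrand_ge0.
rewrite integral_cst//; apply: (@le_trans _ _ ((B ^+ 2 * eta)%:E * (s / 2)%:E)%E).
  by rewrite -EFinM lee_fin /B le_eqVlt; apply/orP; left; apply/eqP; field.
by rewrite lee_pmul2l// lte_fin mulr_gt0// exprn_gt0.
Qed.

(** The test polynomial ((1 + z) / 2)^n has squared modulus ((1 + cos l) / 2)^n, which decreases in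
    |l| on [0, pi]; the region where it is large carries no mass of [f]. *)
Lemma sigma2_le_gap (alpha : R) n : 0 < alpha < pi ->
  {ae mu, forall l, `|l| < alpha -> f l = 0} ->
  (sigma2 n f <= (total * (cos (alpha / 2) ^+ n) ^+ 2)%:E)%E.
Proof.
move=> /andP[a0 api] f0.
pose p : {poly R[i]} := 2^-1 *: ('X + 1%:P).
have qn : Qn1 n (p ^+ n).
  split; last by rewrite horner_exp !hornerE mulVf ?expr1n// pnatr_eq0.
  rewrite (leq_trans (size_poly_exp_leq _ _))// ltnS -[leqRHS]mul1n leq_mul//.
  by rewrite -subn1 leq_subLR (leq_trans (size_scale_leq _ _))// size_XaddC.
have pE l : abs2c p.[expi l] = (1 + cos l) / 2.
  have -> : p.[expi l] = (2^-1)%:C%C * (1 + expi l).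
    by rewrite !hornerE fmorphV rmorph_nat addrC.
  rewrite abs2cM /abs2c /=.
  apply: (@etrans _ _ ((1 + 2 * cos l + (cos l ^+ 2 + sin l ^+ 2)) / 4)).
    by field.
  by rewrite cos2Dsin2; field.
have cosE : (1 + cos alpha) / 2 = cos (alpha / 2) ^+ 2.
  have {1}-> : alpha = (alpha / 2) *+ 2 by rewrite mulr2n; field.
  by rewrite cos_mulr2n; field.
have p_ge0 (l : R) : 0 <= (1 + cos l) / 2.
  by have := abs2c_ge0 p.[expi l]; rewrite pE.
apply: (le_trans (sigma2_le n _ qn)).
(* The bound is rewritten as an n-th power of (1 + cos alpha) / 2, to be compared pointwise with the
   modulus. *)
rewrite -exprM mulnC exprM -cosE EFinM muleC -totalE -ge0_integralZl_EFin//.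
- apply: ae_ge0_le_integral => //.
  + exact: energy_integrand_ge0.
  + exact: measurable_energy.
  + by move=> l lI; rewrite lee_fin mulr_ge0 ?exprn_ge0 ?f_ge0.
  + apply/measurable_EFinP; apply: measurable_funM; first exact: measurable_cst.
    by apply/measurable_EFinP; exact: (measurable_int _ f_int).
  + case: f0 => N [mN N0 subN]; exists N; split=> // l /= nl.
    apply: subN => /= fl; apply: nl => lI.
    rewrite -EFinM lee_fin.
    have [la|la] := ltP `|l| alpha; first by rewrite fl// !mulr0.
    rewrite ler_wpM2r ?f_ge0// horner_exp abs2cX pE.
    rewrite lerXn2r ?nnegrE// ler_pM2r// lerD2l -(cos_norm l).
    move: lI; rewrite /= in_itv/= => lI.
    have lpi : `|l| <= pi by rewrite ler_norml.
    rewrite leNgt ltr_cos ?in_itv/= ?normr_ge0 ?lpi ?(ltW a0) ?(ltW api)//.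
    by rewrite -leNgt.
- exact: (measurable_int _ f_int).
Qed.

End Sigma2.

(** * Limits of the n-th roots *)

Theorem theorem8p2 (R : realType) (f : R -> R) :
  (forall l, l \in `[- pi, pi] -> 0 <= f l) ->
  lebesgue_measure.-integrable `[- pi, pi] (EFin \o f) ->
  (0 < \int[lebesgue_measure]_(l in `[(- pi)%R, pi%R]) (f l)%:E)%E ->
  ((exists2 d : R, 0 < d &
      {ae lebesgue_measure, forall l, l \in `]- d, d[ -> 0 < f l}) ->
    (fun n : nat => sigma n f `^ (n%:R^-1)) @ \oo --> (1 : R))
  /\
  (forall alpha : R, 0 < alpha -> alpha < pi ->
    {ae lebesgue_measure, forall l, `|l| < alpha -> f l = 0} ->
    (limn_esup (fun n : nat => (sigma n f `^ (n%:R^-1))%:E)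
       <= (cos (alpha / 2))%:E)%E).
Proof.
move=> f_ge0 f_int f_pos.
set total := fine (\int[lebesgue_measure]_(l in `[(- pi)%R, pi%R]) (f l)%:E)%E.
have total0 : 0 < total by move: f_pos; rewrite (totalE f f_int) lte_fin.
have rt0 : 0 < Num.sqrt total by rewrite sqrtr_gt0.
split=> [[delta delta0 fpos]|alpha a0 api fgap]; last first.
  have c0 : 0 <= cos (alpha / 2).
    by rewrite cos_ge0_pihalf//; apply/andP; split; lra.
  apply: limn_esup_le_near => e e0.
  have rt := cvg_powR_root _ rt0.
  have c1 : cos (alpha / 2) < 1 + cos (alpha / 2) by lra.
  (* Multiplied by cos(alpha / 2), this slack adds at most [e]. *)
  have le1 : 1 < 1 + e / (1 + cos (alpha / 2)).
    by rewrite ltrDl divr_gt0// (le_lt_trans c0).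
  near=> n; have n0 : (0 < n)%N by near: n; exists 1%N.
  have a0pi : 0 < alpha < pi by rewrite a0.
  apply: le_trans (sigma_root_le f f_ge0 f_int _ _ c0 n0
    (sigma2_le_gap f f_ge0 f_int _ n a0pi fgap)) _.
  apply: (@le_trans _ _ ((1 + e / (1 + cos (alpha / 2))) * cos (alpha / 2))).
    by rewrite ler_wpM2r// ltW//; near: n; exact: cvgr_lt rt _ le1.
  rewrite mulrDl mul1r lerD2l -mulrA ler_piMr ?(ltW e0)// mulrC.
  by rewrite ler_pdivrMr ?mul1r ?(ltW c1)// (le_lt_trans c0).
apply/cvgrPdist_lt => e e0.
(* The lower bound for the roots tends to rho^2 >= 1 - 2h >= 1 - e / 2; the cap 1 keeps [rho]
   positive. *)
pose h := Num.min e 1 / 4; pose rho := 1 - h.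
have [h0 h1 he] : [/\ 0 < h, h <= 4^-1 & h <= e / 4].
  by rewrite /h; split; [rewrite divr_gt0// lt_min e0 ltr01
    |rewrite ler_pdivrMr// mulVf// ge_min lexx orbT
    |rewrite ler_pM2r// ge_min lexx].
have rho01 : 0 < rho < 1 by rewrite /rho; apply/andP; split; lra.
have /andP[rho0 _] := rho01.
have [c c0 Hc] := energy_ge f f_ge0 f_int _ _ delta0 rho01 fpos.
have rc0 : 0 < Num.sqrt c by rewrite sqrtr_gt0.
have lower : (fun n : nat => Num.sqrt c `^ n%:R^-1 * rho ^+ 2) @ \oo --> rho ^+ 2.
  rewrite -[X in _ --> X]mul1r; apply: cvgM; last exact: cvg_cst.
  exact: cvg_powR_root.
have rho_e : 1 - e < rho ^+ 2.
  by rewrite /rho; have := sqr_ge0 h; rewrite expr2; lra.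
near=> n; have n0 : (0 < n)%N by near: n; exists 1%N.
rewrite ltr_norml; apply/andP; split.
  rewrite ltrBrDl -ltrBrDr opprK.
  (* The upper half comes from the constant polynomial, that is r = 1 in [sigma_root_le]. *)
  apply: le_lt_trans (_ : _ <= Num.sqrt total `^ n%:R^-1 * 1) _.
    apply: (sigma_root_le f f_ge0 f_int _ _ ler01 n0).
    by rewrite !expr1n mulr1; exact: sigma2_le_total.
  rewrite mulr1; near: n; apply: cvgr_lt; first exact: cvg_powR_root.
  by rewrite ltrDl.
rewrite ltrBlDr -ltrBlDl.
apply: (@lt_le_trans _ _ (Num.sqrt c `^ n%:R^-1 * rho ^+ 2)).
  by near: n; exact: cvgr_gt lower _ rho_e.
rewrite -powR_root_scale ?sqrtr_ge0 ?exprn_ge0 ?(ltW rho0)//.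
rewrite -sqrt_scale ?(ltW c0) ?exprn_ge0 ?(ltW rho0)//.
rewrite ge0_ler_powR ?invr_ge0 ?nnegrE ?sqrtr_ge0//.
apply: sigma_ge => // q qn; exact: Hc.
Unshelve. all: by end_near. Qed.
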